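(* Let $k$ be a field of characteristic zero, $R=k[x_1,\ldots,x_n]$, and let $\mathbf{f}=\{f_1,\ldots,f_m\}\subset R$ be a set of distinct monomials of degree $2$. If the ideal $I=(\mathbf{f})\subset R$ is linearly presented, then $\mathbf{f}$ is polarizable.
   Context: $I=(\mathbf{f})$ is linearly presented if the module of first syzygies $\{(r_1,\ldots,r_m)\in R^m:\sum_j r_jf_j=0\}$ is generated by syzygies all of whose coordinates are linear forms (or zero). Polarizability. Let $P\subset k[T_1,\ldots,T_m]$ be the kernel of the $k$-algebra map $k[T_1,\ldots,T_m]\to R$, $T_j\mapsto f_j$. Put $\mathcal{Z}=\{(r_1,\ldots,r_m)\in R^m : \sum_{j} r_j\,\partial f_j/\partial x_i=0 \text{ for all } i=1,\ldots,n\}$, and let $\mathcal{P}\subset\mathcal{Z}$ be the $R$-submodule generated by the vectors $\left(\frac{\partial F}{\partial T_1}(\mathbf{f}),\ldots,\frac{\partial F}{\partial T_m}(\mathbf{f})\right)$, $F\in P$. The set $\mathbf{f}$ is polarizable if $\mathcal{P}=\mathcal{Z}$. *)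

(* Defs.v *)
From HB Require Import structures.
From mathcomp Require Import all_boot all_order all_algebra.
From mathcomp Require Import mpoly.

Set Implicit Arguments.
Unset Strict Implicit.
Unset Printing Implicit Defensive.

Import GRing.Theory.
Local Open Scope ring_scope.

(* [in_span S v]: [v] lies in the [R]-submodule generated by [S], i.e. it is
   a finite [R]-linear combination of elements of [S]. *)
Definition in_span (R : nzRingType) (V : lmodType R) (S : V -> Prop) (v : V)
    : Prop :=
  exists (N : nat) (c : 'I_N -> R) (u : 'I_N -> V),
    (forall i, S (u i)) /\ v = \sum_(i < N) c i *: u i.

Section Polarizability.

Variables (k : fieldType) (n m : nat).
Implicit Types (f : m.-tuple {mpoly k[n]}) (r : 'rV[{mpoly k[n]}]_m).

Definition is_monomial_of_degree (d : nat) (p : {mpoly k[n]}) : Prop :=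
  exists2 a : 'X_{1..n}, mdeg a = d & p = 'X_[a].

Definition syzygy f r : Prop := \sum_(j < m) r 0 j * tnth f j = 0.

(* The zero polynomial is [1.-homog]. *)
Definition linear_syzygy f r : Prop :=
  syzygy f r /\ forall j, r 0 j \is 1.-homog.

Definition linearly_presented f : Prop :=
  forall r, syzygy f r <-> in_span (linear_syzygy f) r.

Definition polynomial_relation f (F : {mpoly k[m]}) : Prop := F \mPo f = 0.

Definition differential_syzygy f r : Prop :=
  forall i : 'I_n, \sum_(j < m) r 0 j * (tnth f j)^`M(i) = 0.

Definition polar_syzygy f (F : {mpoly k[m]}) : 'rV[{mpoly k[n]}]_m :=
  \row_(j < m) (F^`M(j) \mPo f).

Definition polar_module f : 'rV[{mpoly k[n]}]_m -> Prop :=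
  in_span (fun r => exists2 F, polynomial_relation f F & r = polar_syzygy f F).

Definition polarizable f : Prop :=
  forall r, polar_module f r <-> differential_syzygy f r.

End Polarizability.

(* Main.v *)
Require Import Defs.
From mathcomp Require Import all_boot all_order all_algebra.
From mathcomp Require Import mpoly ring zify.
Set Implicit Arguments.
Unset Strict Implicit.
Unset Printing Implicit Defensive.
Import GRing.Theory.
Local Open Scope ring_scope.

(** The monomials x_u x_v are the edges (loops allowed) of a graph on the
    variables.  After multiplication of the i-th equation by x_i and
    decomposition into multidegrees, a differential syzygy of multidegree al is
    a vector c of scalars, indexed by the edges dividing x^al, whose weighted
    sum at each vertex vanishes: an element of the kernel of the unsigned
    incidence matrix.  Conversely, a square of edges uv, vw, wz, zu gives the
    quadratic relation T_uv T_wz - T_vw T_zu, and the polar syzygy of this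
    relation, moved to multidegree al, is the vector +1, -1, +1, -1 on the
    square.  It therefore suffices that, inside each multidegree, these square
    vectors span the kernel of the incidence matrix
    ([square_vector_span], [multigraded_square]); the factor 2 below is then
    cancelled, since the characteristic is zero.

    Linear presentation enters through the Koszul syzygy of two coprime
    generators: to write it with linear syzygies, some generator must join a
    variable of the first to a variable of the second
    ([linearly_presented_linked]).  So any two edges of the graph are joined by
    an edge, and this survives restriction to the edges dividing x^al
    ([bounded_edge_gapfree]).

    By duality, the spanning claim says that a function phi on the edges for
    which opposite sides of every square have the same sum comes from a function
    g on the vertices: 2 phi(uv) = g(u) + g(v) ([gapfree_potential]).  Such a g
    is first found on a small part of the graph, then extended by means of
    squares to the neighbours of that part and to the neighbours of these
    ([potential_extension]).  The small part is a closed walk of length 3 if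
    there is one (a loop counts), else a closed walk of length 5, else a single
    vertex of maximal degree; in each case the absence of gaps leaves no edge
    far from it.

    That polar syzygies are differential syzygies is the chain rule
    ([mderiv_comp]). *)

(** * Potentials on graphs whose edges are pairwise joined *)

Section Potential.

Variables (K : comNzRingType) (T : finType) (adj : rel T) (phi : T -> T -> K).
Hypothesis adj_sym : forall a b, adj a b = adj b a.
Hypothesis adj_gapfree : forall a b c d, adj a b -> adj c d ->
  [|| adj a c, adj a d, adj b c | adj b d].
Hypothesis phi_sym : forall a b, phi a b = phi b a.
Hypothesis phi_square : forall a b c d,
  adj a b -> adj b c -> adj c d -> adj d a ->
  phi a b + phi c d = phi b c + phi d a.

(** The factor 2 makes the definition meaningful over every ring: on an odd
    closed walk the values of g are alternating sums of phi, without halves. *)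
Definition has_potential :=
  exists g : T -> K, forall x y, adj x y -> 2 * phi x y = g x + g y.

(** The core is a family of vertices [a i] on which a potential [gam] is known,
    at least along the pairs in [core].  Edges are either seen from a core pair,
    or have one end away from the core and the other in [good]; good vertices
    have pairwise common neighbours in the core. *)
Section Extension.

Variables (I : finType) (a : I -> T) (gam : I -> K).
Variables (core : rel I) (good : pred T).
Hypothesis core_adj : forall i j, core i j -> adj (a i) (a j).
Hypothesis core_potential : forall i j, core i j ->
  2 * phi (a i) (a j) = gam i + gam j.
Hypothesis core_common : forall x i j, i != j -> adj x (a i) -> adj x (a j) ->
  exists2 l, core i l & core l j.
Hypothesis good_share : forall y z, good y -> good z ->
  exists2 i, adj y (a i) & adj z (a i).
Hypothesis edge_cover : forall x y, adj x y ->
  [\/ exists i j, [/\ adj x (a i), adj y (a j) & core i j],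
      (forall i, ~~ adj x (a i)) /\ good y
    | (forall i, ~~ adj y (a i)) /\ good x].

Let near_value x :=
  if [pick i | adj x (a i)] is Some i then 2 * phi x (a i) - gam i else 0.

Let far_value x :=
  if [pick y | adj x y && good y] is Some y then 2 * phi x y - near_value y
  else 0.

Let value x :=
  if [exists i, adj x (a i)] then near_value x else far_value x.

(** Two core neighbours i, j of x have a common core neighbour l, and the square
    x, j, l, i makes the values that they impose on x agree. *)
Lemma near_valueE x i : adj x (a i) -> near_value x = 2 * phi x (a i) - gam i.
Proof.
rewrite /near_value => xi; case: pickP => [j xj|/(_ i)]; last by rewrite xi.
have [->//|neq_ji] := eqVneq j i.
have [l jl li] := core_common neq_ji xj xi.
have sq := phi_square xj (core_adj jl) (core_adj li) _.
have {}sq := sq (etrans (adj_sym _ _) xi).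
have jlE := core_potential jl; have liE := core_potential li.
rewrite (phi_sym (a i)) in sq.
have -> : 2 * phi x (a j) = 2 * phi x (a i) + (gam j + gam l) - (gam l + gam i).
  rewrite -jlE -liE.
  have -> : phi x (a j) = phi (a j) (a l) + phi x (a i) - phi (a l) (a i).
    by rewrite -sq; ring.
  by ring.
by ring.
Qed.

Lemma valueE x i : adj x (a i) -> value x = 2 * phi x (a i) - gam i.
Proof.
move=> xi; rewrite /value; case: existsP => [_|[]]; first exact: near_valueE.
by exists i.
Qed.

(** Two good neighbours y, z of x have a common core neighbour, and the square
    that they form with x makes the values that they impose on x agree. *)
Lemma far_valueE x y : (forall i, ~~ adj x (a i)) -> good y -> adj x y ->
  value x = 2 * phi x y - value y.
Proof.
move=> farx goody xy.
have [i yi _] := good_share goody goody.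
rewrite {1}/value; case: existsP => [[j]|_]; first by rewrite (negPf (farx j)).
rewrite /far_value; case: pickP => [z /andP[xz goodz]|/(_ y)]; last first.
  by rewrite xy goody.
have [j yj zj] := good_share goody goodz.
rewrite (near_valueE zj) (valueE yj).
have sq : phi x y + phi (a j) z = phi y (a j) + phi z x.
  by apply: phi_square; rewrite // adj_sym.
rewrite (phi_sym z x) (phi_sym (a j)) in sq.
have -> : phi x z = phi x y + phi z (a j) - phi y (a j) by rewrite sq; ring.
by ring.
Qed.

Lemma potential_extension : has_potential.
Proof.
exists value => x y xy; case: (edge_cover xy) => [[i [j [xi yj ij]]]|[]|[]].
- rewrite (valueE xi) (valueE yj).
  have sq : phi x (a i) + phi (a j) y = phi (a i) (a j) + phi y x.
    by apply: phi_square; rewrite ?core_adj // adj_sym.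
  rewrite (phi_sym y x) (phi_sym (a j)) in sq.
  have -> : phi x y = phi x (a i) + phi y (a j) - phi (a i) (a j).
    by rewrite sq; ring.
  have -> : 2 * (phi x (a i) + phi y (a j) - phi (a i) (a j)) =
    2 * phi x (a i) + 2 * phi y (a j) - 2 * phi (a i) (a j) by ring.
  by rewrite (core_potential ij); ring.
- by move=> farx goody; rewrite (far_valueE farx goody xy); ring.
- move=> fary goodx; rewrite adj_sym in xy.
  by rewrite (far_valueE fary goodx xy) phi_sym; ring.
Qed.

End Extension.

(** Each edge xy is joined to the three edges ab, bc, ca, so the neighbours of x
    and y include at least two of the three positions a, b, c.  Either two
    distinct positions are seen from different ends, or one end sees nothing and
    the other, which is then good, sees two positions.  Since a, b, c are
    treated as positions, they need not be distinct: a loop is the case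
    a = b = c. *)
Lemma triangle_potential a b c :
  adj a b -> adj b c -> adj c a -> has_potential.
Proof.
move=> ab bc ca.
pose v (i : 'I_3) := nth a [:: a; b; c] i.
pose gam (i : 'I_3) := nth 0 [:: phi a b + phi c a - phi b c;
  phi a b + phi b c - phi c a; phi b c + phi c a - phi a b] i.
pose i0 : 'I_3 := @Ordinal 3 0 isT.
pose i1 : 'I_3 := @Ordinal 3 1 isT.
pose i2 : 'I_3 := @Ordinal 3 2 isT.
pose good x :=
  [|| adj x a && adj x b, adj x b && adj x c | adj x a && adj x c].
have ba := etrans (adj_sym b a) ab; have cb := etrans (adj_sym c b) bc.
have ac := etrans (adj_sym a c) ca.
have Eba := phi_sym b a; have Ecb := phi_sym c b; have Eac := phi_sym a c.
apply: (@potential_extension _ v gam [rel i j | i != j] good).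
- by case=> [[|[|[|//]]] ?] [[|[|[|//]]] ?].
- case=> [[|[|[|//]]] ?] [[|[|[|//]]] ?] //= _;
    rewrite /v /gam /= ?Eba ?Ecb ?Eac; ring.
- move=> x [[|[|[|//]]] ?] [[|[|[|//]]] ?] //= _ _ _;
    by (exists i0 + exists i1 + exists i2).
- move=> y z; rewrite /good => /or3P[]/andP[y1 y2] /or3P[]/andP[z1 z2];
    by (exists i0 + exists i1 + exists i2).
move=> x y xy.
have := adj_gapfree xy ab; have := adj_gapfree xy bc; have := adj_gapfree xy ca.
have far z : ~~ adj z a -> ~~ adj z b -> ~~ adj z c ->
    forall i, ~~ adj z (v i).
  by move=> ? ? ? [[|[|[|//]]] ?].
have hit i j : adj x (v i) -> adj y (v j) -> i != j ->
    exists i j, [/\ adj x (v i), adj y (v j) & i != j] by exists i, j.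
have := far x; have := far y.
have := hit i0 i1; have := hit i0 i2; have := hit i1 i2.
have := hit i1 i0; have := hit i2 i0; have := hit i2 i1.
(* What remains is a tautology in the six adjacencies of x and y to a, b, c. *)
rewrite /v /good /=; clear.
case: (adj x a) (adj x b) (adj x c) (adj y a) (adj y b) (adj y c)
  => [] [] [] [] [] [] H1 H2 H3 H4 H5 H6 far1 far2 // _ _ _;
  by [constructor 1; auto | constructor 2; auto | constructor 3; auto].
Qed.

(** Without triangles a vertex sees no two consecutive positions of the
    pentagon, hence at most two positions.  The positions seen from the ends of
    an edge cover the five sides of the pentagon, so there are at least three of
    them; two of these are consecutive, hence seen from different ends. *)
Lemma pentagon_potential a b c d e :
    (forall x y z, adj x y -> adj y z -> ~~ adj z x) ->
  adj a b -> adj b c -> adj c d -> adj d e -> adj e a -> has_potential.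
Proof.
move=> triangle_free ab bc cd de ea.
pose v (i : 'I_5) := nth a [:: a; b; c; d; e] i.
pose gam (i : 'I_5) := nth 0
  [:: phi a b - phi b c + phi c d - phi d e + phi e a;
      phi b c - phi c d + phi d e - phi e a + phi a b;
      phi c d - phi d e + phi e a - phi a b + phi b c;
      phi d e - phi e a + phi a b - phi b c + phi c d;
      phi e a - phi a b + phi b c - phi c d + phi d e] i.
pose i0 : 'I_5 := @Ordinal 5 0 isT.
pose i1 : 'I_5 := @Ordinal 5 1 isT.
pose i2 : 'I_5 := @Ordinal 5 2 isT.
pose i3 : 'I_5 := @Ordinal 5 3 isT.
pose i4 : 'I_5 := @Ordinal 5 4 isT.
pose core (i j : 'I_5) :=
  (j == i.+1 %% 5 :> nat)%N || (i == j.+1 %% 5 :> nat)%N.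
have ba := etrans (adj_sym b a) ab; have cb := etrans (adj_sym c b) bc.
have dc := etrans (adj_sym d c) cd; have ed := etrans (adj_sym e d) de.
have ae := etrans (adj_sym a e) ea.
have Eba := phi_sym b a; have Ecb := phi_sym c b; have Edc := phi_sym d c.
have Eed := phi_sym e d; have Eae := phi_sym a e.
have no_two x p q : adj p q -> ~~ (adj x p && adj x q).
  move=> pq; apply/negP => /andP[xp xq].
  by have := triangle_free _ _ _ xp pq; rewrite adj_sym xq.
apply: (@potential_extension _ v gam core pred0) => //.
- by case=> [[|[|[|[|[|//]]]]] ?] [[|[|[|[|[|//]]]]] ?].
- case=> [[|[|[|[|[|//]]]]] ?] [[|[|[|[|[|//]]]]] ?] //= _;
    rewrite /v /gam /= ?Eba ?Ecb ?Edc ?Eed ?Eae; ring.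
- move=> x; have := no_two x _ _ ab; have := no_two x _ _ bc.
  have := no_two x _ _ cd; have := no_two x _ _ de; have := no_two x _ _ ea.
  move=> n1 n2 n3 n4 n5.
  case=> [[|[|[|[|[|//]]]]] ?] [[|[|[|[|[|//]]]]] ?] //= _;
    rewrite /v /= => xp xq;
    first [ by rewrite xp xq in n1 | by rewrite xp xq in n2
          | by rewrite xp xq in n3 | by rewrite xp xq in n4
          | by rewrite xp xq in n5
          | by (exists i0 + exists i1 + exists i2 + exists i3 + exists i4) ].
move=> x y xy; constructor 1.
have hit i j : adj x (v i) && adj y (v j) -> core i j ->
    exists i j, [/\ adj x (v i), adj y (v j) & core i j].
  by case/andP=> ? ? ?; exists i, j.
suff : [|| adj x a && adj y b, adj x b && adj y c, adj x c && adj y d,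
   adj x d && adj y e, adj x e && adj y a, adj x b && adj y a,
   adj x c && adj y b, adj x d && adj y c, adj x e && adj y d
   | adj x a && adj y e].
  case/or4P => [||| /or4P [||| /or4P[]]] H.
  - exact: (hit i0 i1).
  - exact: (hit i1 i2).
  - exact: (hit i2 i3).
  - exact: (hit i3 i4).
  - exact: (hit i4 i0).
  - exact: (hit i1 i0).
  - exact: (hit i2 i1).
  - exact: (hit i3 i2).
  - exact: (hit i4 i3).
  - exact: (hit i0 i4).
have := adj_gapfree xy ab; have := adj_gapfree xy bc; have := adj_gapfree xy cd.
have := adj_gapfree xy de; have := adj_gapfree xy ea.
have := no_two x _ _ ab; have := no_two x _ _ bc.
have := no_two x _ _ cd; have := no_two x _ _ de; have := no_two x _ _ ea.
have := no_two y _ _ ab; have := no_two y _ _ bc.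
have := no_two y _ _ cd; have := no_two y _ _ de; have := no_two y _ _ ea.
(* What remains is a tautology in the ten adjacencies of x and y to the walk. *)
clear.
case: (adj x a) (adj x b) (adj x c) (adj x d) (adj x e) => [] [] [] [] [] //;
by case: (adj y a) (adj y b) (adj y c) (adj y d) (adj y e) => [] [] [] [] [].
Qed.

(** Let a have maximal degree.  If an edge xy had no end adjacent to a, every
    neighbour of a would be adjacent to x or to y.  A neighbour w adjacent to x
    and a neighbour z adjacent to y give the closed walk a, w, x, y, z of length
    5, so all of them are adjacent to x, say; then x has in addition the
    neighbour y and its degree exceeds that of a.  Hence each edge has an end
    adjacent to a, and exactly one because there is no triangle. *)
Lemma bipartite_potential :
    (forall x y z, adj x y -> adj y z -> ~~ adj z x) ->
    (forall a b c d e,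
      adj a b -> adj b c -> adj c d -> adj d e -> ~~ adj e a) ->
  has_potential.
Proof.
move=> triangle_free pentagon_free.
have [x0 _|T0] := pickP (@predT T); last by exists (fun=> 0) => x; have := T0 x.
pose a := [arg max_(x > x0) #|[pred y | adj x y]|].
have maxa x : (#|[pred y | adj x y]| <= #|[pred y | adj a y]|)%N.
  by rewrite /a; case: arg_maxnP => // z _ H; apply: H.
have absorb x y : adj x y -> (forall z, adj a z -> adj x z) -> adj a y.
  move=> xy sub; apply/idPn => nay; have := maxa x; rewrite leqNgt.
  move=> /negP[]; apply: proper_card; apply/properP; split.
    by apply/subsetP => z; apply: sub.
  by exists y; rewrite !inE.
have touch x y : adj x y -> adj x a || adj y a.
  move=> xy; apply/idPn; rewrite negb_or => /andP[nxa nya].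
  have split z : adj a z -> adj x z || adj y z.
    move=> az; have := adj_gapfree az xy.
    by rewrite !(adj_sym a) (negPf nxa) (negPf nya) /= !(adj_sym z).
  have [xall|] := boolP [forall z, adj a z ==> adj x z].
    case/negP: nya; rewrite adj_sym; apply: (absorb x) => // z.
    by move/forallP/(_ z)/implyP: xall; apply.
  rewrite negb_forall => /existsP[z]; rewrite negb_imply => /andP[az nxz].
  have yz : adj y z by have := split _ az; rewrite (negPf nxz).
  case/negP: nxa; rewrite adj_sym; apply: (absorb y); first by rewrite adj_sym.
  move=> w aw; have := split _ aw => /orP[xw|//].
  by have := pentagon_free a w x y z aw (etrans (adj_sym _ _) xw) xy yz;
    rewrite adj_sym az.
apply: (@potential_extension unit (fun=> a) (fun=> 0) (fun _ _ => false)
         (adj^~ a)) => //.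
move=> x y xy; have /orP[xa|ya] := touch _ _ xy.
  constructor 3; split=> // _; rewrite adj_sym.
  by apply: (triangle_free y x a); rewrite // adj_sym.
constructor 2; split=> // _.
by rewrite adj_sym; apply: (triangle_free x y a).
Qed.

Theorem gapfree_potential : has_potential.
Proof.
have [/existsP[a /existsP[b /existsP[c /and3P[ab bc ca]]]]|no3] :=
  boolP [exists a, exists b, exists c, [&& adj a b, adj b c & adj c a]].
  exact: triangle_potential ab bc ca.
have triangle_free x y z : adj x y -> adj y z -> ~~ adj z x.
  move=> xy yz; apply: contra no3 => zx.
  by apply/existsP; exists x; apply/existsP; exists y; apply/existsP; exists z;
     apply/and3P.
have [/existsP[a /existsP[b /existsP[c /existsP[d /existsP[e]]]]]|no5] :=
  boolP [exists a, exists b, exists c, exists d, exists e,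
    [&& adj a b, adj b c, adj c d, adj d e & adj e a]].
  by case/and5P; apply: pentagon_potential.
apply: bipartite_potential => // a b c d e ab bc cd de.
apply: contra no5 => ea; apply/existsP; exists a; apply/existsP; exists b.
apply/existsP; exists c; apply/existsP; exists d; apply/existsP; exists e.
by apply/and5P.
Qed.

End Potential.

(** * Spans *)

Section Span.

Variables (R : nzRingType) (V : lmodType R) (S : V -> Prop).

Lemma in_span_gen v : S v -> in_span S v.
Proof.
move=> Sv; exists 1, (fun=> 1), (fun=> v); split=> //.
by rewrite big_ord1 scale1r.
Qed.

Lemma in_span0 : in_span S 0.
Proof. by exists 0, (fun=> 0), (fun=> 0); split; [case | rewrite big_ord0]. Qed.

Lemma in_spanD v w : in_span S v -> in_span S w -> in_span S (v + w).
Proof.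
move=> [N [c [u [Su ->]]]] [M [d [t [St ->]]]].
exists (N + M)%N, (fun i => match split i with inl a => c a | inr b => d b end).
exists (fun i => match split i with inl a => u a | inr b => t b end); split.
  by move=> i; case: (split i).
rewrite big_split_ord /=; congr (_ + _); apply: eq_bigr => i _.
  by rewrite (unsplitK (inl i)).
by rewrite (unsplitK (inr i)).
Qed.

Lemma in_spanZ a v : in_span S v -> in_span S (a *: v).
Proof.
move=> [N [c [u [Su ->]]]]; exists N, (fun i => a * c i), u; split=> //.
by rewrite scaler_sumr; apply: eq_bigr => i _; rewrite scalerA.
Qed.

Lemma in_span_sum (I : finType) (F : I -> V) :
  (forall i, in_span S (F i)) -> in_span S (\sum_i F i).
Proof.
move=> SF; elim/big_ind: _ => //; [exact: in_span0 | exact: in_spanD].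
Qed.

End Span.

(** A vector outside the row space is detected by a column of the cokernel. *)
Lemma row_span_dual (K : fieldType) (N m : nat) (A : 'M[K]_(N, m))
    (c : 'rV[K]_m) :
    (forall y : 'cV[K]_m, A *m y = 0 -> c *m y = 0) ->
  in_span (fun v => exists i, v = row i A) c.
Proof.
move=> dual; have : (c <= A)%MS.
  rewrite submxE; apply/eqP/matrixP => i j.
  have := dual (col j (cokermx A)).
  rewrite colE (mulmxA A) (mulmxA c) mulmx_coker mul0mx -colE.
  by move=> /(_ erefl)/matrixP/(_ i 0); rewrite !mxE.
case/submxP => D ->; exists N, (fun i => D 0 i), (fun i => row i A); split.
  by move=> i; exists i.
by rewrite mulmx_sum_row.
Qed.

(** * The squares of one multidegree *)

Section Multidegree.

Variables (n m : nat).
Implicit Types (a b : 'X_{1..n}).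

Lemma lem_mdeg_eq a b : (a <= b)%MM -> mdeg a = mdeg b -> a = b.
Proof.
move=> le_ab; have := congr1 mdeg (submK le_ab); rewrite mdegD => deg deg_ab.
have /eqP : mdeg (b - a) = 0%N by lia.
by rewrite mdeg_eq0 => /eqP ba; rewrite -(submK le_ab) ba add0m.
Qed.

Lemma edge_through a u : mdeg a = 2 -> a u != 0%N ->
  exists v, a = (U_(u) + U_(v))%MM.
Proof.
move=> a2; rewrite -lep1mP => /submK aE.
have /eqP/mdeg1P[v /eqP av] : mdeg (a - U_(u))%MM = 1%N.
  by have := congr1 mdeg aE; rewrite mdegD mdeg1; lia.
by exists v; rewrite -aE av addmC.
Qed.

Lemma edge_ends a : mdeg a = 2 -> exists u v, a = (U_(u) + U_(v))%MM.
Proof.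
move=> a2; have [u au|a0] := pickP (fun u => a u != 0%N).
  by exists u; apply: edge_through.
have : a = 0%MM.
  by apply/mnmP => u; rewrite mnm0E; apply/eqP/negbFE; exact: a0.
by move=> az; move: a2; rewrite az mdeg0.
Qed.

Lemma edge_le u v b : (U_(u) + U_(v) <= b)%MM =
  [&& b u != 0, b v != 0 & (u == v) ==> (1 < b u)]%N.
Proof.
apply/mnm_lepP/and3P => [H|[bu bv uv] i].
  have := H u; have := H v; rewrite !mnmDE !mnm1E !eqxx.
  rewrite (eq_sym v); case: (u == v) => /= *; split=> //; lia.
rewrite mnmDE !mnm1E; case: (eqVneq u i) => [<-|_]; last first.
  by case: (eqVneq v i) => [<-|//]; lia.
by move: uv; rewrite (eq_sym v); case: (u == v) => /=; lia.
Qed.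

Variable (e : 'I_m -> 'X_{1..n}).
Hypothesis e_inj : injective e.
Hypothesis e_deg : forall j, mdeg (e j) = 2.
Hypothesis e_linked : forall j l,
  (forall u, e j u != 0%N -> e l u = 0%N) ->
  exists i u, [/\ i != j, e l u != 0%N & (e i <= e j + U_(u))%MM].

Variable (al : 'X_{1..n}).

(** A loop at u is bounded only if x_u^2 divides x^al, so this may be a proper
    subgraph of the one induced on the support of x^al. *)
Definition bounded_edge u v :=
  [exists j, (e j == U_(u) + U_(v))%MM && (e j <= al)%MM].

Lemma bounded_edgeP u v :
  reflect (exists2 j, e j = (U_(u) + U_(v))%MM & (e j <= al)%MM)
          (bounded_edge u v).
Proof.
apply: (iffP existsP) => [[j /andP[/eqP]]|[j ej le]]; first by exists j.
by exists j; rewrite ej eqxx -ej.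
Qed.

Lemma bounded_edge_sym u v : bounded_edge u v = bounded_edge v u.
Proof. by apply: eq_existsb => j; rewrite addmC. Qed.

(** The linking generator is not a loop, because it joins two coprime
    monomials; so it divides x^al as soon as both of its variables do. *)
Lemma bounded_edge_gapfree (a b c d : 'I_n) :
    bounded_edge a b -> bounded_edge c d ->
  [|| bounded_edge a c, bounded_edge a d, bounded_edge b c | bounded_edge b d].
Proof.
move=> ab cd.
have [->|ac] := eqVneq a c; first by rewrite cd !orbT.
have [->|ad] := eqVneq a d; first by rewrite bounded_edge_sym cd.
have [->|bc] := eqVneq b c; first by rewrite cd !orbT.
have [->|bd] := eqVneq b d; first by rewrite (bounded_edge_sym d c) cd !orbT.
case/bounded_edgeP: ab => j ej lej; case/bounded_edgeP: cd => l el lel.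
have disj u : e j u != 0%N -> e l u = 0%N.
  rewrite ej el !mnmDE !mnm1E.
  have [<-|_] := eqVneq a u.
    by rewrite !(eq_sym _ a) (negPf ac) (negPf ad).
  have [<-|//] := eqVneq b u; by rewrite !(eq_sym _ b) (negPf bc) (negPf bd).
have [i [u [neq_ij lu le_i]]] := e_linked disj.
(* By coprimality x_u divides f_l only, so f_i, which is not f_j, involves x_u
   once and its other variable comes from f_j. *)
have ju : e j u = 0%N by apply/eqP/negPn/negP => /disj lu0; rewrite lu0 in lu.
have iu : e i u != 0%N.
  apply: contra neq_ij => /eqP iu.
  apply/eqP/e_inj/lem_mdeg_eq; rewrite ?e_deg //.
  apply/mnm_lepP => w; have := mnm_lepP le_i w; rewrite mnmDE mnm1E.
  by have [<-|_] := eqVneq u w; rewrite ?iu ?addn0.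
have [z ez] := edge_through (e_deg i) iu.
have jz : e j z != 0%N.
  have := mnm_lepP le_i z; rewrite ez !mnmDE !mnm1E eqxx; lia.
have uz : u != z by apply: contraNneq jz => <-; rewrite ju.
have edge_uz : bounded_edge u z.
  apply/bounded_edgeP; exists i => //; rewrite ez edge_le (negPf uz) /=.
  rewrite andbT; have := mnm_lepP lel u; have := mnm_lepP lej z; lia.
have : (z == a) || (z == b).
  move: jz; rewrite ej mnmDE !mnm1E !(eq_sym z).
  by case: (a == z); case: (b == z).
have : (u == c) || (u == d).
  move: lu; rewrite el mnmDE !mnm1E !(eq_sym u).
  by case: (c == u); case: (d == u).
rewrite bounded_edge_sym in edge_uz.
by do 2![case/orP=> /eqP ?]; subst; rewrite edge_uz ?orbT.
Qed.

Definition bounded_square (q : 'I_m * 'I_m * ('I_m * 'I_m)) :=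
  (e q.1.1 + e q.1.2 == e q.2.1 + e q.2.2)%MM
  && (e q.1.1 + e q.1.2 <= al)%MM.

(** A vertex occurs at most twice on the walk; if it occurs twice, at
    consecutive places, the walk traverses its loop, and x_u^2 divides x^al. *)
Lemma bounded_square_closed_walk (a b c d : 'I_n) (i j k l : 'I_m) :
    e i = (U_(a) + U_(b))%MM -> e j = (U_(c) + U_(d))%MM ->
    e k = (U_(b) + U_(c))%MM -> e l = (U_(d) + U_(a))%MM ->
    (e i <= al)%MM -> (e j <= al)%MM -> (e k <= al)%MM -> (e l <= al)%MM ->
    a != c -> b != d ->
  bounded_square ((i, j), (k, l)).
Proof.
move=> ei ej ek el li lj lk ll ac bd; apply/andP; split => /=.
  by apply/eqP/mnmP => u; rewrite ei ej ek el !mnmDE; lia.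
apply/mnm_lepP => u; have := mnm_lepP li u; have := mnm_lepP lj u.
have := mnm_lepP lk u; have := mnm_lepP ll u.
have : ~~ ((a == u) && (c == u)).
  by apply: contra ac => /andP[/eqP-> /eqP->].
have : ~~ ((b == u) && (d == u)).
  by apply: contra bd => /andP[/eqP-> /eqP->].
rewrite ei ej ek el !mnmDE !mnm1E; move: (al u); clear.
by case: (a == u) (b == u) (c == u) (d == u) => [] [] [] []; lia.
Qed.

Variable (K : fieldType).
Hypothesis char_neq2 : 2 != 0 :> K.

Definition square_vector (q : 'I_m * 'I_m * ('I_m * 'I_m)) : 'rV[K]_m :=
  delta_mx 0 q.1.1 + delta_mx 0 q.1.2 - delta_mx 0 q.2.1 - delta_mx 0 q.2.2.

(** If y annihilates all square vectors, the coefficients of y form a function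
    on edges with a potential g, so that 2 y_j is the sum of e_j(u) g(u) over u.
    Then 2 c.y is a combination of the incidence equations satisfied by c. *)
Lemma square_vector_span (c : 'rV[K]_m) :
    (forall j, c 0 j != 0 -> (e j <= al)%MM) ->
    (forall u, \sum_j (e j u)%:R * c 0 j = 0) ->
  in_span (fun v => exists2 q, bounded_square q & v = square_vector q) c.
Proof.
move=> c_supp c_ker.
pose squares := [pred q | bounded_square q].
pose A : 'M[K]_(#|squares|, m) := \matrix_i square_vector (enum_val i).
have [] : in_span (fun v => exists i, v = row i A) c; last first.
  move=> N [D [v [vA ->]]]; exists N, D, v; split=> // i.
  have [l ->] := vA i; exists (enum_val l); first exact: (enum_valP l).
  by rewrite rowK.
apply: row_span_dual => y Ay.
have y_square q : bounded_square q ->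
    y q.1.1 0 + y q.1.2 0 = y q.2.1 0 + y q.2.2 0.
  move=> sq; have /rowP/(_ 0) : square_vector q *m y = 0.
    have := congr1 (row (enum_rank_in (sq : q \in squares) q)) Ay.
    by rewrite row_mul rowK enum_rankK_in // row0.
  rewrite /square_vector !mulmxBl mulmxDl -!rowE !mxE => y0.
  by apply/eqP; rewrite -subr_eq0 opprD addrA y0.
pose phi u v :=
  if [pick j | e j == (U_(u) + U_(v))%MM] is Some j then y j 0 else 0.
have phiE j u v : e j = (U_(u) + U_(v))%MM -> phi u v = y j 0.
  move=> ej; rewrite /phi; case: pickP => [i /eqP ei|/(_ j)]; last first.
    by rewrite ej eqxx.
  by congr (y _ 0); apply: e_inj; rewrite ei ej.
have phi_sym u v : phi u v = phi v u.
  by rewrite /phi; under eq_pick do rewrite addmC.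
have phi_square (a b c' d : 'I_n) : bounded_edge a b -> bounded_edge b c' ->
    bounded_edge c' d -> bounded_edge d a ->
    phi a b + phi c' d = phi b c' + phi d a.
  (* On a walk that backtracks the identity is trivial. *)
  have [->|ac] := eqVneq a c'; first by rewrite (phi_sym b) (phi_sym d).
  have [->|bd] := eqVneq b d; first by rewrite addrC (phi_sym a) (phi_sym c').
  move=> /bounded_edgeP[i ei li] /bounded_edgeP[k ek lk].
  move=> /bounded_edgeP[j ej lj] /bounded_edgeP[l el ll].
  rewrite (phiE _ _ _ ei) (phiE _ _ _ ej) (phiE _ _ _ ek) (phiE _ _ _ el).
  have sq := bounded_square_closed_walk ei ej ek el li lj lk ll ac bd.
  exact: (y_square _ sq).
have [g gE] := gapfree_potential bounded_edge_sym bounded_edge_gapfree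
  phi_sym phi_square.
have y_potential j : (e j <= al)%MM -> 2 * y j 0 = \sum_u (e j u)%:R * g u.
  move=> le_j; have [u [v ej]] := edge_ends (e_deg j).
  rewrite -(phiE _ _ _ ej) gE; last by apply/bounded_edgeP; exists j.
  under eq_bigr do rewrite ej mnmDE !mnm1E natrD mulrDl.
  rewrite big_split /= (bigD1 u) // [in X in _ = _ + X](bigD1 v) //=.
  rewrite !eqxx !mul1r !big1 ?addr0 // => w neq_w;
    by rewrite eq_sym (negPf neq_w) mul0r.
apply/rowP => i; rewrite ord1 !mxE; apply: (mulfI char_neq2).
rewrite mulr0 mulr_sumr.
under eq_bigr => j _.
  rewrite (_ : 2 * _ = \sum_u g u * ((e j u)%:R * c 0 j)); first over.
  have [->|cj] := eqVneq (c 0 j) 0.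
    by rewrite mul0r mulr0 big1 // => u _; rewrite !mulr0.
  rewrite mulrCA y_potential ?c_supp // mulr_sumr.
  by apply: eq_bigr => u _; ring.
rewrite exchange_big big1 //= => u _.
by rewrite -mulr_sumr c_ker mulr0.
Qed.

End Multidegree.

(** * Coefficients, and the chain rule *)

Section MonomialCoefficients.

Variables (n : nat) (K : nzRingType).
Implicit Types (p q : {mpoly K[n]}) (a b : 'X_{1..n}).

Lemma mcoeffMX_le p a b :
  (p * 'X_[a])@_b = if (a <= b)%MM then p@_(b - a) else 0.
Proof.
case: ifPn => [le_ab|nle]; first by rewrite -{1}(submK le_ab) addmC mcoeffMX.
apply: memN_msupp_eq0; apply: contra nle.
by rewrite (perm_mem (msuppMX _ _)) => /mapP[c _ ->]; exact: lem_addr.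
Qed.

Lemma mderiv_var (i j : 'I_n) : ('X_i : {mpoly K[n]})^`M(j) = (i == j)%:R.
Proof.
rewrite mderivX mnm1E; case: eqP => [->|_]; last by rewrite scale0r.
rewrite scale1r (_ : (_ - _)%MM = 0%MM) ?mpolyX0 //.
by apply/mnmP => k; rewrite mnmBE subnn mnm0E.
Qed.

End MonomialCoefficients.

Section ChainRule.

Variables (K : comNzRingType) (n m : nat) (f : m.-tuple {mpoly K[n]}).

Lemma mderiv_comp (F : {mpoly K[m]}) (i : 'I_n) :
  (F \mPo f)^`M(i) = \sum_(j < m) (F^`M(j) \mPo f) * (tnth f j)^`M(i).
Proof.
pose chain (G : {mpoly K[m]}) :=
  (G \mPo f)^`M(i) = \sum_(j < m) (G^`M(j) \mPo f) * (tnth f j)^`M(i).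
have chainD G H : chain G -> chain H -> chain (G + H).
  rewrite /chain => cG cH; rewrite comp_mpolyD mderivD cG cH -big_split.
  by apply: eq_bigr => j _; rewrite mderivD comp_mpolyD mulrDl.
have chainZ c G : chain G -> chain (c *: G).
  rewrite /chain => cG; rewrite comp_mpolyZ mderivZ cG scaler_sumr.
  by apply: eq_bigr => j _; rewrite mderivZ comp_mpolyZ scalerAl.
have chainM G H : chain G -> chain H -> chain (G * H).
  rewrite /chain => cG cH; rewrite rmorphM mderivM cG cH mulr_suml mulr_sumr.
  rewrite -big_split; apply: eq_bigr => j _.
  by rewrite mderivM comp_mpolyD !rmorphM /=; ring.
have chain1 : chain 1.
  rewrite /chain comp_mpoly1 -mpolyC1 mderivC big1 // => j _.
  by rewrite mderivC comp_mpoly0 mul0r.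
have chainX j : chain 'X_j.
  rewrite /chain comp_mpolyXU -tnth_nth (bigD1 j) //= mderiv_var eqxx.
  rewrite comp_mpoly1 mul1r big1 ?addr0 // => l neq_lj.
  by rewrite mderiv_var eq_sym (negPf neq_lj) comp_mpoly0 mul0r.
rewrite -/(chain F); elim/mpolyind: F => [|c a G _ _ cG].
  by rewrite -(scale0r 1); exact: chainZ.
apply: chainD => //; apply: chainZ; rewrite mpolyXE_id.
elim/big_ind: _ => // j _; elim: (a j) => [|d IH]; first by rewrite expr0.
by rewrite exprS; apply: chainM.
Qed.

End ChainRule.

(** * Syzygies of monomials *)

Section QuadraticMonomials.

Variables (K : fieldType) (n m : nat) (f : m.-tuple {mpoly K[n]}).
Variable (e : 'I_m -> 'X_{1..n}).
Hypothesis fE : forall j, tnth f j = 'X_[e j].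

Lemma polar_syzygy_differential (r : 'rV_m) :
  polar_module f r -> differential_syzygy f r.
Proof.
move=> [N [c [u [polar ->]]]] i.
have u_diff l : \sum_j u l 0 j * (tnth f j)^`M(i) = 0.
  have [F F0 ->] := polar l.
  under eq_bigr do rewrite mxE.
  by rewrite -mderiv_comp F0 mderiv0.
under eq_bigr do rewrite summxE mulr_suml.
rewrite exchange_big big1 //= => l _.
under eq_bigr do rewrite mxE -mulrA.
by rewrite -mulr_sumr u_diff mulr0.
Qed.

(** In an expression of the Koszul syzygy of f_j and f_l through linear ones,
    some linear syzygy s has in its j-th coordinate a variable x_u dividing f_l.
    As s is a syzygy, the term x_u f_j cancels against a term of another
    generator, which therefore divides x_u f_j. *)
Lemma linearly_presented_linked : linearly_presented f -> injective e ->
  (forall j, mdeg (e j) = 2) -> forall j l,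
  (forall u, e j u != 0%N -> e l u = 0%N) ->
  exists i u, [/\ i != j, e l u != 0%N & (e i <= e j + U_(u))%MM].
Proof.
move=> f_linear e_inj e_deg j l disj.
have neq_jl : j != l.
  apply/eqP => jl; subst l; have /eqP := e_deg j.
  rewrite (_ : e j = 0%MM) ?mdeg0 //; apply/mnmP => u; rewrite mnm0E.
  by apply/eqP/negPn/negP => ju; have ju0 := disj u ju; rewrite ju0 in ju.
pose koszul : 'rV[{mpoly K[n]}]_m :=
  'X_[e l] *: delta_mx 0 j - 'X_[e j] *: delta_mx 0 l.
have koszul_syz : syzygy f koszul.
  rewrite /syzygy (bigD1 j) // (bigD1 l) 1?eq_sym //= big1 => [|i /andP[ij il]].
    rewrite !mxE !eqxx (eq_sym l) (negPf neq_jl) !fE /=; ring.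
  by rewrite !mxE !eqxx (negPf ij) (negPf il) /=; ring.
have [N [c [s [lin koszulE]]]] := (f_linear koszul).1 koszul_syz.
have [i Ni] : exists i, (c i * s i 0 j)@_(e l) != 0.
  apply/existsP; apply: contraTT (oner_neq0 K) => none; rewrite negbK.
  have : (koszul 0 j)@_(e l) = 1.
    by rewrite !mxE !eqxx (negPf neq_jl) mulr0 subr0 mulr1 mcoeffX eqxx.
  rewrite koszulE summxE raddf_sum big1 => [<- //|i _] /=.
  rewrite mxE; apply/eqP; move: none; rewrite negb_exists => /forallP/(_ i).
  by rewrite negbK.
have [syz hom] := lin i.
have [u le_u su] : exists2 u, (U_(u) <= e l)%MM & (s i 0 j)@_U_(u) != 0.
  move: Ni; rewrite -mcoeff_msupp => /msuppM_le/allpairsP[[a b] /= [ca sb elE]].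
  have /eqP/mdeg1P[u /eqP bu] := dhomogP _ _ _ (hom j) _ sb; subst b.
  by exists u; rewrite -?mcoeff_msupp // elE lem_addl.
(* The monomial x_u f_j must occur a second time in the syzygy. *)
have [i' neq_ij Ni'] : exists2 i', i' != j &
    (s i 0 i' * 'X_[e i'])@_(U_(u) + e j) != 0.
  apply/exists_inP; apply: contraNT su; rewrite negb_exists => /forallP none.
  have := congr1 (mcoeff (U_(u) + e j)%MM) syz.
  rewrite mcoeff0 (bigD1 j) //= mcoeffD fE addmC mcoeffMX raddf_sum big1 /=.
    by rewrite addr0 => ->.
  move=> i' neq_ij; rewrite fE addmC; apply/eqP.
  by have := none i'; rewrite neq_ij negbK.
exists i', u; split=> //; first by rewrite -lep1mP.
by move: Ni'; rewrite mcoeffMX_le addmC; case: ifP => //; rewrite eqxx.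
Qed.

Section Homogenize.

Variable (al : 'X_{1..n}).

(** Multidegrees are such that the j-th basis vector has the degree of f_j. *)
Definition multigraded (c : 'rV[K]_m) : 'rV[{mpoly K[n]}]_m :=
  \row_j (c 0 j *: (if (e j <= al)%MM then 'X_[al - e j] else 0)).

(** For the relation T_i T_j - T_k T_l, multiplication of the T_i-derivative by
    the complement of f_i f_j in x^al gives x^al / f_i, because that derivative
    takes the value f_j. *)
Lemma multigraded_square q : bounded_square e al q ->
  polar_module f (multigraded (square_vector K q)).
Proof.
case: q => [[i j] [k l]] /andP[/= /eqP sq le_al].
pose F : {mpoly K[m]} := 'X_i * 'X_j - 'X_k * 'X_l.
have compX h : 'X_h \mPo f = 'X_[e h].
  by rewrite comp_mpolyXU -tnth_nth fE.
have F0 : polynomial_relation f F.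
  rewrite /polynomial_relation comp_mpolyB !rmorphM /= !compX.
  by rewrite -!mpolyXD sq subrr.
have -> : multigraded (square_vector K ((i, j), (k, l))) =
    'X_[al - (e i + e j)] *: polar_syzygy f F; last first.
  by apply/in_spanZ/in_span_gen; exists F.
apply/rowP => h; rewrite !mxE !eqxx /= mderivB !mderivM !mderiv_var.
rewrite comp_mpolyB !comp_mpolyD !rmorphM /= !compX !rmorph_nat.
pose M := if (e h <= al)%MM then 'X_[al - e h] else 0 : {mpoly K[n]}.
have term a b : (e a + e b <= al)%MM ->
    'X_[al - (e a + e b)] * ((a == h)%:R * 'X_[e b]) = (a == h)%:R * M.
  move=> le_ab; have [ah|_] := eqVneq a h; last by rewrite !mul0r mulr0.
  rewrite /M -ah (lepm_trans (lem_addr _ _) le_ab) !mul1r -mpolyXD.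
  congr 'X_[_]; apply/mnmP => u; have := mnm_lepP le_ab u.
  by rewrite !mnmDE !mnmBE !mnmDE; lia.
have scale_bool (b : bool) : (b%:R : K) *: M = b%:R * M.
  by rewrite scaler_nat mulr_natl.
have le_kl : (e k + e l <= al)%MM by rewrite -sq.
have le_ji : (e j + e i <= al)%MM by rewrite addmC.
have le_lk : (e l + e k <= al)%MM by rewrite addmC.
rewrite -/M !scalerBl scalerDl !(eq_sym h) !scale_bool.
rewrite -(term _ _ le_al) -(term _ _ le_ji) -(term _ _ le_kl) -(term _ _ le_lk).
rewrite (addmC (e j)) (addmC (e l)) -sq.
by rewrite (mulrC 'X_[e i]) (mulrC 'X_[e k]) mulrBr !mulrDr opprD addrA.
Qed.

End Homogenize.

(** The component of multidegree al of r consists of the coefficients of the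
    products r_j f_j at x^al, since the degree of f_j is added to that of r_j.
    The bound B exceeds the degrees of all these products. *)
Lemma multigraded_decomposition (r : 'rV[{mpoly K[n]}]_m) : exists B : nat,
  r = \sum_(al : 'X_{1..n < B})
        multigraded al (\row_j (r 0 j * tnth f j)@_al).
Proof.
pose F j := msize (r 0 j * tnth f j).
exists (\max_(j < m) F j)%N; apply/rowP => j.
rewrite summxE; apply: (@mulIf _ (tnth f j)).
  by rewrite fE -mleadc_eq0 mleadXm mcoeffX eqxx oner_eq0.
have size_le : (F j <= \max_(j < m) F j)%N by exact: leq_bigmax.
rewrite mulr_suml [LHS](mpolywE size_le).
apply: eq_bigr => al _; rewrite !mxE -scalerAl fE mcoeffMX_le.
case: ifP => le_al; last by rewrite !scale0r.
by rewrite -mpolyXD submK.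
Qed.

(** Multiplication by x_u turns the partial derivative of a monomial into its
    multiple by the exponent of x_u. *)
Lemma differential_syzygy_kernel (r : 'rV_m) al u : differential_syzygy f r ->
  \sum_j (e j u)%:R * (r 0 j * tnth f j)@_al = 0.
Proof.
move=> /(_ u) /(congr1 (fun p => ('X_u * p)@_al)).
rewrite mulr0 mcoeff0 mulr_sumr raddf_sum => diff0; rewrite -[RHS]diff0.
apply: eq_bigr => j _ /=.
rewrite fE mderivX -!scalerAr mcoeffZ.
have [-> |ju] := eqVneq (e j u) 0%N; first by rewrite !mul0r.
by rewrite mulrCA -mpolyXD addmC submK // lep1mP.
Qed.

End QuadraticMonomials.

Theorem proposition5p18 (k : fieldType) (n m : nat)
    (f : m.-tuple {mpoly k[n]})
    (char0 : [pchar k] =i pred0)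
    (f_distinct : uniq f)
    (f_monomial : forall j : 'I_m, is_monomial_of_degree 2 (tnth f j))
    (f_linear : linearly_presented f) :
  polarizable f.
Proof.
pose e j := mlead (tnth f j).
have fE j : tnth f j = 'X_[e j].
  by rewrite /e; have [a _ ->] := f_monomial j; rewrite mleadXm.
have e_deg j : mdeg (e j) = 2.
  by rewrite /e; have [a deg_a ->] := f_monomial j; rewrite mleadXm.
have e_inj : injective e.
  move=> i j eij; apply: (tuple_uniqP _ f_distinct).
  by rewrite !fE eij.
move=> r; split; first exact: polar_syzygy_differential.
move=> r_diff; have [B ->] := multigraded_decomposition fE r.
apply: in_span_sum => al; set c := \row_j _.
have c_supp j : c 0 j != 0 -> (e j <= al)%MM.
  by rewrite mxE fE mcoeffMX_le; case: ifP => //; rewrite eqxx.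
have c_ker u : \sum_j (e j u)%:R * c 0 j = 0.
  under eq_bigr do rewrite mxE.
  exact: differential_syzygy_kernel.
have char_neq2 : 2 != 0 :> k by rewrite ((pcharf0P k).1 char0).
have [N [d [v [squares ->]]]] := square_vector_span e_inj e_deg
  (linearly_presented_linked fE f_linear e_inj e_deg) char_neq2 c_supp c_ker.
have -> : multigraded e al (\sum_i d i *: v i) =
    \sum_i (d i)%:MP *: multigraded e al (v i).
  apply/rowP => j; rewrite mxE !summxE scaler_suml; apply: eq_bigr => i _.
  by rewrite !mxE mul_mpolyC scalerA.
apply: in_span_sum => i; have [q sq ->] := squares i.
exact/in_spanZ/multigraded_square.
Qed.
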